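(* Let $P\subset\mathbb{R}^d$ be a deeply smooth $d$-dimensional polytope with the origin in its interior, and suppose that the origin is next to a certain vertex $v$ of $P$. Then $\mathcal{E}(P)$ contains the lattice basis of $\mathbb{Z}^d$ consisting of the primitive edge vectors of $P$ at $v$.
   Context: A $d$-dimensional polytope in $\mathbb{R}^d$ is smooth if it is simple, rational, and the primitive edge-direction vectors at each vertex form a basis of $\mathbb{Z}^d$; it is a lattice polytope if its vertices are in $\mathbb{Z}^d$. A smooth lattice polytope $P$ is deeply smooth if for every vertex $v$, with primitive edge vectors $u_1,\dots,u_d$ at $v$ (pointing away from $v$ along the edges), $P$ contains $\{v+\sum_{i=1}^d\lambda_iu_i:\lambda_i\in[0,1]\ \forall i\}$. $\mathcal{E}(P):=\mathbb{Z}^d\cap P\cap(-P)$. The lattice distance from $x_0$ to a facet with affine hull $\{x:u\cdot x=b\}$, $u\in\mathbb{Z}^d$ primitive, is $|b-u\cdot x_0|$. For a face $F$ of $P$ and $x_0\in P$, the distance from $x_0$ to $F$ is the maximum of the lattice distances from $x_0$ to the facets containing $F$. The point $x_0$ is next to $F$ if it is in the interior of $P$ and at distance one from $F$. *)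

(* Defs.v *)
From HB Require Import structures.
From mathcomp Require Import all_boot all_order all_algebra.
From mathcomp Require Import all_classical all_reals all_analysis.

Set Implicit Arguments.
Unset Strict Implicit.
Unset Printing Implicit Defensive.

Import Order.TTheory GRing.Theory Num.Theory.
Import numFieldNormedType.Exports.

Local Open Scope classical_set_scope.
Local Open Scope ring_scope.

Section Polytopes.
Variables (R : realType) (d : nat).
Local Notation V := 'rV[R]_d.
Local Notation Zd := 'rV[int]_d.
Implicit Types (P F G A : set V) (v x : V) (u z : Zd).

Definition dotp (c x : V) : R := \sum_(i < d) c 0 i * x 0 i.

(* Integer vectors have type 'rV[int]_d; intv embeds them in R^d. *)
Definition intv z : V := map_mx intr z.

Definition convex_hull A : set V :=
  [set x | exists n (p : 'I_n -> V) (a : 'I_n -> R),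
     [/\ forall i, A (p i), forall i, 0 <= a i, \sum_i a i = 1
       & x = \sum_i a i *: p i]].

Definition affine_hull A : set V :=
  [set x | exists n (p : 'I_n -> V) (a : 'I_n -> R),
     [/\ forall i, A (p i), \sum_i a i = 1 & x = \sum_i a i *: p i]].

(* The empty set has no dimension in this sense (usually it is given -1). *)
Definition has_dim A (k : nat) : Prop :=
  exists (x0 : V) (U : {vspace V}),
    \dim U = k /\ affine_hull A = [set x | x - x0 \in U].

Definition polytope P : Prop :=
  exists s : seq V, P = convex_hull [set` s].

(* Improper faces are included: c = 0 gives P itself and the empty set. *)
Definition face P F : Prop :=
  exists (c : V) (b : R),
    (forall x, P x -> dotp c x <= b) /\ F = [set x | P x /\ dotp c x = b].

Definition vertex P v : Prop := face P [set v].

Definition edge P F : Prop := face P F /\ has_dim F 1.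

(* A facet has codimension one in R^d, so P is meant to be d-dimensional. *)
Definition facet P F : Prop := face P F /\ exists2 k, has_dim F k & k.+1 = d.

Definition primitive u : Prop := \big[gcdn/0%N]_(i < d) `|(u 0%R i)|%N = 1%N.

Definition edge_vectors P v : set Zd :=
  [set u | primitive u /\
     exists F, [/\ edge P F, F v & exists2 t : R, 0 < t & F (v + t *: intv u)]].

Definition lattice_basis (B : set Zd) : Prop :=
  exists b : 'I_d -> Zd,
    (forall z, exists! c : Zd, z = \sum_i c 0 i *: b i) /\ B = range b.

Definition simple P : Prop :=
  forall v, vertex P v -> ([set F | edge P F /\ F v] #= `I_d)%card.

Definition rational P : Prop :=
  forall F, edge P F ->
    exists2 u, u != 0 &
      forall x y : V, F x -> F y -> exists t : R, y - x = t *: intv u.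

Definition smooth P : Prop :=
  [/\ polytope P, has_dim P d, simple P, rational P
    & forall v, vertex P v -> lattice_basis (edge_vectors P v)].

Definition lattice_polytope P : Prop :=
  polytope P /\ forall v, vertex P v -> range intv v.

(* For smooth P the set edge_vectors P v has d elements, so any u : 'I_d -> Zd
   with that range lists them without repetition. *)
Definition deeply_smooth P : Prop :=
  [/\ smooth P, lattice_polytope P &
   forall v, vertex P v -> forall u : 'I_d -> Zd, range u = edge_vectors P v ->
   forall lam : 'I_d -> R, (forall i, 0 <= lam i <= 1) ->
     P (v + \sum_i lam i *: intv (u i))].

Definition ewald P : set V := range intv `&` P `&` [set - x | x in P].

(* Relational, since only facets with a rational normal have a lattice distance;
   (u, b) is determined by F up to a common sign. *)
Definition facet_distance F x (r : R) : Prop :=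
  exists u (b : R),
    [/\ primitive u, affine_hull F = [set y | dotp (intv u) y = b]
      & r = `|b - dotp (intv u) x|].

Definition face_distance P F x (r : R) : Prop :=
  let D := [set s | exists G, [/\ facet P G, F `<=` G & facet_distance G x s]] in
  D r /\ ubound D r.

Definition next_to P F x : Prop := P° x /\ face_distance P F x 1.

End Polytopes.

(* Main.v *)
Require Import Defs.
From HB Require Import structures.
From mathcomp Require Import all_boot all_order all_algebra.
From mathcomp Require Import all_classical all_reals all_analysis.
From mathcomp Require Import ring lra.
Import Order.TTheory GRing.Theory Num.Theory.
Import numFieldNormedType.Exports.
Local Open Scope classical_set_scope.
Local Open Scope ring_scope.

(** Let [w_1, ..., w_d] be the edge basis at a vertex [v'] and [n_1, ..., n_d]
    its dual basis ([dual_basis]).  The coordinates [z_l(x) = n_l . (x - v')]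
    are nonnegative on [P], because a polytope lies in the cone spanned by its
    edges at a vertex ([edge_vectors_span_cone]).  Hence each [z_l = 0] cuts
    out a facet ([coordinate_facet]), whose lattice distance from the origin is
    [z_l(0)], a positive integer.  If that facet contains [v], being next to
    [v] forces [z_l(0) = 1].

    Suppose now that [v] is on the line through [v'] in the direction of one of
    these edges, say [w_i].  All facets at [v'], except possibly the [i]-th,
    contain [v], so [0 = v' + sum_(l != i) w_l + m w_i] with [m >= 1].
    Deep smoothness puts [v' + sum_(l != i) w_l = - m w_i] in [P], and by convexity with the origin
    [- w_i] is in [P] as well ([opposite_edge_vector]).

    For an edge vector [u] at [v], taking [v' = v] and [w_i = u] gives [- u] in
    [P].  The edge in the direction [u] ends at another vertex, where [- u] is
    an edge vector ([edge_other_end]); taking that end for [v'] and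
    [w_i = - u] gives [u] in [P].

    The facts about polytopes rest on the finite set of generators and one
    device: if [c.x <= b] on [P], with equality on a face, then a large multiple
    of [b - c.x] bounds from above any affine function that is nonpositive on
    that face ([dominating_multiple]).  So a face of a face of [P] is cut out by
    a single functional. *)

(** * The scalar product and integer vectors *)

Section Dot.
Context {R : realType} {d : nat}.
Implicit Types (c x y : 'rV[R]_d).

Lemma dotpDr c x y : dotp c (x + y) = dotp c x + dotp c y.
Proof. by rewrite /dotp -big_split; apply: eq_bigr => i _; rewrite mxE mulrDr. Qed.

Lemma dotpZr c a x : dotp c (a *: x) = a * dotp c x.
Proof. by rewrite /dotp mulr_sumr; apply: eq_bigr => i _; rewrite mxE mulrCA. Qed.

Lemma dotpBr c x y : dotp c (x - y) = dotp c x - dotp c y.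
Proof. by rewrite -scaleN1r dotpDr dotpZr mulN1r. Qed.

Lemma dotp0r c : dotp c 0 = 0.
Proof. by rewrite -(scale0r 0) dotpZr mul0r. Qed.

Lemma dotp_sumr c n (F : 'I_n -> 'rV[R]_d) :
  dotp c (\sum_i F i) = \sum_i dotp c (F i).
Proof. exact: (big_morph _ (dotpDr c) (dotp0r c)). Qed.

Lemma dotpC c x : dotp c x = dotp x c.
Proof. by apply: eq_bigr => i _; rewrite mulrC. Qed.

Lemma dotpDl c x y : dotp (x + y) c = dotp x c + dotp y c.
Proof. by rewrite !(dotpC _ c) dotpDr. Qed.

Lemma dotpZl c a x : dotp (a *: x) c = a * dotp x c.
Proof. by rewrite !(dotpC _ c) dotpZr. Qed.

Lemma dotpBl c x y : dotp (x - y) c = dotp x c - dotp y c.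
Proof. by rewrite !(dotpC _ c) dotpBr. Qed.

Lemma dotp_gt0 x : x != 0 -> 0 < dotp x x.
Proof.
move=> xn0; rewrite lt_neqAle eq_sym /dotp; apply/andP; split; last first.
  by apply: sumr_ge0 => i _; rewrite -expr2 sqr_ge0.
apply: contra xn0 => /eqP h; apply/eqP/rowP => i; rewrite mxE.
have /psumr_eq0P : forall i, true -> 0 <= x 0 i * x 0 i.
  by move=> j _; rewrite -expr2 sqr_ge0.
by move=> /(_ h i isT)/eqP; rewrite mulf_eq0 orbb => /eqP.
Qed.

Lemma dotp_intv (u z : 'rV[int]_d) :
  dotp (intv R u) (intv R z) = (\sum_i u 0 i * z 0 i)%:~R.
Proof.
by rewrite /dotp rmorph_sum; apply: eq_bigr => i _; rewrite !mxE rmorphM.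
Qed.

Lemma intvN (u : 'rV[int]_d) : intv R (- u) = - intv R u.
Proof. exact: map_mxN. Qed.

Lemma intv_eq0 (u : 'rV[int]_d) : (intv R u == 0) = (u == 0).
Proof.
apply/eqP/eqP => [h|->]; last exact: map_mx0.
by apply/rowP => i; move/rowP: h => /(_ i)/eqP; rewrite !mxE intr_eq0 => /eqP.
Qed.

Lemma primitive_neq0 (u : 'rV[int]_d) : primitive u -> u != 0.
Proof.
rewrite /primitive; apply: contra_eq_neq => ->.
by rewrite big1 // => i _; rewrite mxE.
Qed.

Lemma primitiveN (u : 'rV[int]_d) : primitive u -> primitive (- u).
Proof. by rewrite /primitive; under [in X in _ -> X]eq_bigr do rewrite mxE abszN. Qed.

(** A common divisor of the entries of [u] divides this integer combination
    of them, hence is a unit. *)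
Lemma primitive_of_dual (u z : 'rV[int]_d) :
  \sum_i u 0 i * z 0 i = 1 -> primitive u.
Proof.
set g := (\big[gcdn/0%N]_(i < d) `|u 0%R i|%N) => h.
have gd i : (g%:Z %| u 0%R i)%Z.
  by rewrite dvdzE /g /= (bigD1 i) //= dvdn_gcdl.
have : (g%:Z %| 1%R)%Z by rewrite -h; apply: rpred_sum => i _; rewrite dvdz_mulr.
by rewrite dvdzE /= dvdn1 => /eqP.
Qed.

Lemma primitive_scaling (u : 'rV[int]_d) : u != 0 ->
  exists2 w : 'rV[int]_d, primitive w &
    exists2 k : R, 0 < k & intv R u = k *: intv R w.
Proof.
set g := (\big[gcdn/0%N]_(i < d) `|u 0%R i|%N) => un0.
have gd i : (g%:Z %| u 0%R i)%Z.
  by rewrite dvdzE /g /= (bigD1 i) //= dvdn_gcdl.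
have g0 : (0 < g)%N.
  rewrite lt0n; apply: contra un0 => /eqP g0; apply/eqP/rowP => i.
  by move: (gd i); rewrite g0 dvd0z mxE => /eqP.
pose w : 'rV[int]_d := \row_i (u 0%R i %/ g%:Z)%Z.
have uw i : u 0 i = w 0 i * g%:Z by rewrite mxE divzK.
exists w; last first.
  exists g%:R; first by rewrite ltr0n.
  by apply/rowP => i; rewrite [LHS]mxE [RHS]mxE [in RHS]mxE uw intrM mulrC.
have mg : forall n (F : 'I_n -> nat), \big[gcdn/0%N]_i (F i * g)%N =
    (\big[gcdn/0%N]_i F i * g)%N.
  by move=> n F; rewrite -(big_morph (muln^~ g) (fun a e => muln_gcdl a e g) (mul0n g)).
rewrite /primitive; apply/eqP; rewrite -(eqn_pmul2r g0) mul1n -mg; apply/eqP.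
by rewrite {2}/g; apply: eq_bigr => i _; rewrite uw abszM.
Qed.

(** Expanding the standard basis in [b] gives an integer left inverse of the
    matrix with rows [b i]; it is also a right inverse, and its columns are the
    dual basis.  Each [n i] is primitive since it takes the value 1 at [b i].
    The real expansion follows from the same matrix identity. *)
Lemma dual_basis (b : 'I_d -> 'rV[int]_d) :
  (forall z, exists! c : 'rV[int]_d, z = \sum_i c 0 i *: b i) ->
  exists n : 'I_d -> 'rV[int]_d,
  [/\ forall i, primitive (n i),
      forall i j, dotp (intv R (n i)) (intv R (b j)) = (i == j)%:R
    & forall x, x = \sum_i dotp (intv R (n i)) x *: intv R (b i)].
Proof.
move=> hb.
have /choice [M hM] : forall i : 'I_d, exists c : 'rV[int]_d,
    delta_mx 0 i = \sum_j c 0 j *: b j.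
  by move=> i; have [c [hc _]] := hb (delta_mx 0 i); exists c.
pose A : 'M[int]_d := \matrix_(i, j) M i 0 j.
pose B : 'M[int]_d := \matrix_(i, j) b i 0 j.
have AB : A *m B = 1%:M.
  apply/matrixP => i j; rewrite !mxE.
  have /rowP /(_ j) := hM i; rewrite summxE !mxE eqxx /= eq_sym => ->.
  by apply: eq_bigr => k _; rewrite !mxE.
have BA := mulmx1C AB.
pose n i : 'rV[int]_d := \row_j A j i.
have nb i j : \sum_k n i 0 k * b j 0 k = (i == j)%:R.
  have /matrixP /(_ j i) := BA; rewrite !mxE eq_sym => <-.
  by apply: eq_bigr => k _; rewrite !mxE mulrC.
exists n; split.
- by move=> i; apply: (@primitive_of_dual _ (b i)); rewrite nb eqxx.
- by move=> i j; rewrite dotp_intv nb; case: (i == j).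
move=> x; apply/rowP => j; rewrite summxE.
have -> : x 0 j = \sum_k x 0 k * (\sum_i A k i * B i j)%:~R.
  have e k : \sum_i A k i * B i j = (k == j)%:R.
    by have /matrixP /(_ k j) := AB; rewrite !mxE.
  rewrite (bigD1 j) //= e eqxx mulr1 big1 ?addr0 // => k /negbTE kj.
  by rewrite e kj mulr0.
under eq_bigr do rewrite rmorph_sum mulr_sumr.
rewrite exchange_big; apply: eq_bigr => i _; rewrite [RHS]mxE /dotp mulr_suml.
by apply: eq_bigr => k _; rewrite !mxE rmorphM; ring.
Qed.
End Dot.

(** * Convex hulls of finite sets *)

Section Hull.
Context {R : realType} {d : nat}.
Local Notation V := 'rV[R]_d.
Implicit Types (A P : set V) (s : seq V) (c x y : V).

Lemma sub_convex_hull A : A `<=` convex_hull A.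
Proof.
move=> x Ax; exists 1%N, (fun=> x), (fun=> 1).
by split=> //; rewrite big_ord1 ?scale1r.
Qed.

Lemma convex_hull_le {A c b} : (forall p, A p -> dotp c p <= b) ->
  forall x, convex_hull A x -> dotp c x <= b.
Proof.
move=> h x [n [p [a [Ap a0 a1 ->]]]].
rewrite dotp_sumr -[leRHS]mul1r -a1 mulr_suml; apply: ler_sum => i _.
by rewrite dotpZr ler_wpM2l // h.
Qed.

Lemma convex_hull_segment {A x y} {t : R} : 0 <= t <= 1 ->
  convex_hull A x -> convex_hull A y -> convex_hull A (t *: x + (1 - t) *: y).
Proof.
move=> /andP[t0 t1] [n [p [a [Ap a0 a1 ->]]]] [m [q [b [Aq b0 b1 ->]]]].
exists (n + m)%N, (fun i => match fintype.split i with inl j => p j | inr j => q j end),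
  (fun i => match fintype.split i with inl j => t * a j | inr j => (1 - t) * b j end).
split.
- by move=> i; case: fintype.split.
- by move=> i; case: fintype.split => j; rewrite mulr_ge0 // subr_ge0.
- rewrite big_split_ord /=.
  under eq_bigr do rewrite (unsplitK (inl _)).
  under [X in _ + X]eq_bigr do rewrite (unsplitK (inr _)).
  by rewrite -!mulr_sumr a1 b1 !mulr1 addrC subrK.
- rewrite big_split_ord /= !scaler_sumr; congr (_ + _); apply: eq_bigr => i _.
    by rewrite (unsplitK (inl _)) scalerA.
  by rewrite (unsplitK (inr _)) scalerA.
Qed.

Lemma seq_argmax {T : eqType} {s : seq T} (f : T -> R) {x0 : T} : x0 \in s ->
  exists2 p, p \in s & {in s, forall q, f q <= f p}.
Proof.
elim: s x0 => // x s IH x0 _.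
case: s IH => [_|y s /(_ y (mem_head _ _))[p ps hp]].
  by exists x; rewrite ?mem_head // => q; rewrite inE => /eqP->.
have [le|/ltW le] := leP (f x) (f p).
  exists p; first by rewrite inE ps orbT.
  by move=> q; rewrite inE => /predU1P[->//|/hp].
exists x; first exact: mem_head.
by move=> q; rewrite inE => /predU1P[->//|/hp /le_trans]; apply.
Qed.

(** Only finitely many ratios [g p / f p] have to be bounded. *)
Lemma dominating_multiple {T : eqType} (s : seq T) (f g : T -> R) :
  {in s, forall p, 0 <= f p} -> {in s, forall p, f p = 0 -> g p <= 0} ->
  exists2 N, 0 <= N & {in s, forall p, g p <= N * f p}.
Proof.
elim: s => [|x s IH] f0 g0; first by exists 0.
have [p ps|p ps|N N0 hN] := IH; first by apply: f0; rewrite inE ps orbT.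
  by apply: g0; rewrite inE ps orbT.
have fx : 0 <= f x by apply: f0; exact: mem_head.
have [M M0 hM] : exists2 M, 0 <= M & g x <= M * f x.
  have [fx0|fxn0] := eqVneq (f x) 0.
    by exists 0; rewrite // mul0r g0 ?mem_head.
  exists (`|g x| / f x); first by rewrite divr_ge0.
  by rewrite divfK // ler_norm.
exists (N + M); first exact: addr_ge0.
move=> p; rewrite inE => /predU1P[->|ps].
  by rewrite (le_trans hM)// ler_wpM2r// lerDr.
rewrite (le_trans (hN _ ps))// ler_wpM2r ?lerDl//.
by apply: f0; rewrite inE ps orbT.
Qed.

(** Among the points of [s] that minimise [n], take one, [p], farthest from the
    origin: by [2 p.q = |p|^2 + |q|^2 - |p - q|^2], the functional [p] itself is
    strictly larger at [p] than at the other minimisers, and subtracting a large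
    multiple of [n] handles the points that are not minimisers. *)
Lemma exposed_minimizer {s} (n : V) {x0} : x0 \in s ->
  exists2 p, p \in s & {in s, forall q, dotp n p <= dotp n q} /\
    exists c, {in s, forall q, q != p -> dotp c q < dotp c p}.
Proof.
move=> x0s.
have [p0 p0s hp0] := seq_argmax (fun q => - dotp n q) x0s.
pose s0 := [seq q <- s | dotp n q == dotp n p0].
have p0s0 : p0 \in s0 by rewrite mem_filter eqxx.
have [p] := seq_argmax (fun q => dotp q q) p0s0.
rewrite mem_filter => /andP[/eqP np ps] hp.
have min q : q \in s -> dotp n p <= dotp n q.
  by move=> /hp0; rewrite np lerN2.
have far q : q \in s -> dotp n q = dotp n p -> q != p -> dotp p q < dotp p p.
  move=> qs nq qp; have := hp q; rewrite mem_filter nq np eqxx => /(_ qs) le.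
  have := dotp_gt0 (q - p); rewrite subr_eq0 => /(_ qp).
  by rewrite !(dotpBl, dotpBr) (dotpC q p); lra.
exists p => //; split=> //.
have [q qs||N N0 hN] := dominating_multiple s (fun q => dotp n q - dotp n p)
    (fun q => dotp p q - dotp p p).
- by rewrite subr_ge0 min.
- move=> q qs /eqP; rewrite subr_eq0 => /eqP nq.
  have [->|/(far q qs nq)/ltW] := eqVneq q p; first by rewrite subrr.
  by rewrite subr_le0.
(* [N + 1] instead of [N] makes the inequality strict off the minimisers. *)
exists (p - (N + 1) *: n) => q qs qp; rewrite !(dotpBl, dotpZl).
have := hN q qs; have := min q qs; rewrite le_eqVlt => /predU1P[nq|].
  by have := far q qs (esym nq) qp; rewrite nq; lra.
by lra.
Qed.

(** Otherwise [c] stays below [b] by a fixed amount on the finite set [s], hence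
    on its hull. *)
Lemma face_has_generator {s c b x} :
  {in s, forall p, dotp c p <= b} -> convex_hull [set` s] x -> dotp c x = b ->
  exists2 p, p \in s & dotp c p = b.
Proof.
move=> sb sx cx; apply: contrapT => no.
have [p ps|p ps /eqP|N N0 hN] :=
    dominating_multiple s (fun p => b - dotp c p) (fun=> 1).
- by rewrite subr_ge0 sb.
- by rewrite subr_eq0 => /eqP h; case: no; exists p.
have : dotp (N *: c) x <= N * b - 1.
  apply: (@convex_hull_le [set` s] _ _) sx => p /= /hN; rewrite dotpZl; lra.
by rewrite dotpZl cx; lra.
Qed.
End Hull.

(** * Edges and vertices of polytopes *)

Section Faces.
Context {R : realType} {d : nat}.
Local Notation V := 'rV[R]_d.
Implicit Types (P F : set V) (c n v x y : V) (u w : 'rV[int]_d).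

Lemma edge_on_line {P F} {u} {v x} {t : R} : Defs.rational P -> edge P F ->
  u != 0 -> t != 0 -> F v -> F (v + t *: intv R u) -> F x ->
  exists k : R, x = v + k *: intv R u.
Proof.
move=> ratP eF un0 tn0 Fv Ft Fx; have [u' u'n0 line] := ratP _ eF.
have [t' et'] := line _ _ Fv Ft; have [a ea] := line _ _ Fv Fx.
move: et'; rewrite addrC addKr => et'.
have t'n0 : t' != 0.
  apply: contra_neq tn0 => t'0; apply/eqP; move/eqP: et'.
  by rewrite t'0 scale0r scaler_eq0 intv_eq0 (negbTE un0) orbF.
exists (a * t'^-1 * t); rewrite -scalerA et' scalerA divfK // -ea.
by rewrite addrC subrK.
Qed.

(** The other end is the point of the edge [F] where the functional [u] is
    largest, found among the generators of [P].  It is a vertex of [P] because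
    [u + (N + 1) c], with [c] the functional that cuts out [F], attains its
    maximum over [P] there only. *)
Lemma edge_other_end {P v} {u} :
  polytope P -> Defs.rational P -> edge_vectors P v u ->
  exists v', [/\ vertex P v', edge_vectors P v' (- u)
    & exists k : R, v = v' + k *: intv R (- u)].
Proof.
move=> [s eP] ratP [pu [F [eF Fv [t t0 Ft]]]].
have [[c [b [Pcb eqF]]] dimF] := eF.
have un0 : u != 0 by exact: primitive_neq0.
have Ps p : p \in s -> P p by rewrite eP => ps; exact: sub_convex_hull.
have scb : {in s, forall p, dotp c p <= b} by move=> p /Ps /Pcb.
have [p ps cp] : exists2 p, p \in s & dotp c p = b.
  by move: Fv; rewrite eqF eP => -[sv cv]; exact: face_has_generator scb sv cv.
have [v'] := seq_argmax (s := [seq q <- s | dotp c q == b]) (dotp (intv R u)) (x0 := p)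
  ltac:(by rewrite mem_filter ps cp eqxx).
rewrite mem_filter => /andP[/eqP cv' v's max].
have Fv' : F v' by rewrite eqF; split=> //; exact: Ps.
have [q qs|q qs /eqP|N N0 hN] := dominating_multiple s (fun q => b - dotp c q)
    (fun q => dotp (intv R u) q - dotp (intv R u) v').
- by rewrite subr_ge0 scb.
- rewrite subr_eq0 eq_sym subr_le0 => cq; apply: max.
  by rewrite mem_filter cq.
have PN x : P x -> dotp (intv R u) x - dotp (intv R u) v' <= N * (b - dotp c x).
  rewrite eP => Px.
  suff : dotp (intv R u + N *: c) x <= dotp (intv R u) v' + N * b.
    by rewrite dotpDl dotpZl; lra.
  apply: convex_hull_le Px => q /= /hN; rewrite dotpDl dotpZl; lra.
have [k ek] := edge_on_line ratP eF un0 (lt0r_neq0 t0) Fv Ft Fv'.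
have uu0 : 0 < dotp (intv R u) (intv R u) by rewrite dotp_gt0 // intv_eq0.
have k0 : 0 < k.
  have := PN (v + t *: intv R u); rewrite eqF in Ft.
  case: Ft => PFt cFt => /(_ PFt); rewrite cFt subrr mulr0.
  rewrite ek !dotpDr !dotpZr => H.
  rewrite -(pmulr_lgt0 _ uu0); apply: lt_le_trans (_ : t * dotp (intv R u) (intv R u) <= _).
    exact: mulr_gt0.
  by lra.
have ev : v = v' + k *: intv R (- u) by rewrite intvN ek scalerN addrK.
exists v'; split; last by exists k.
- exists (intv R u + (N + 1) *: c), (dotp (intv R u) v' + (N + 1) * b); split.
    move=> x Px; rewrite dotpDl dotpZl; have := PN x Px; have := Pcb x Px; lra.
  apply/seteqP; split=> [x /= ->|x /= [Px]].
    by rewrite dotpDl dotpZl cv'; split=> //; exact: Ps.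
  rewrite dotpDl dotpZl => ex; have := PN x Px; have := Pcb x Px => xb xN.
  (* Equality says that [u] gains [N + 1] times the defect [b - c.x], while it
     can gain at most [N] times that defect; so the defect vanishes. *)
  have cx : dotp c x = b by lra.
  have Fx : F x by rewrite eqF.
  have [a ea] := edge_on_line ratP eF un0 (lt0r_neq0 t0) Fv Ft Fx.
  rewrite ea ek; congr (_ + _ *: _).
  move: ex; rewrite cx => /addIr; rewrite ea ek !dotpDr !dotpZr => /addrI.
  by apply: mulIf; rewrite gt_eqF.
- split; first exact: primitiveN.
  by exists F; split=> //; exists k => //; rewrite -ev.
Qed.

(** This is the inclusion of [P] in the cone at [v] spanned by its edges, in
    dual form.  Scale the generators [p - v] of the cone of [P] at [v] to a
    hyperplane [c0 = -1], where [c0] exposes [v].  If [n] is negative on one of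
    these directions, some direction [h] that minimises [n] is exposed among
    them, by [c] say; then [c + (c.h) c0] is nonpositive on the cone and
    vanishes only along [h].  So [h] is the direction of an edge at [v] on which
    [n] is negative. *)
Lemma edge_vectors_span_cone {P v n} :
  polytope P -> Defs.rational P -> vertex P v ->
  (forall u, edge_vectors P v u -> 0 <= dotp n (intv R u)) ->
  forall x, P x -> dotp n v <= dotp n x.
Proof.
move=> [s eP] ratP [c0 [b0 [Pb0 eqv]]] hn.
have Ps p : p \in s -> P p by rewrite eP => ps; exact: sub_convex_hull.
have [Pv cv] : P v /\ dotp c0 v = b0.
  by have : [set v] v by []; rewrite eqv.
pose tau p := dotp c0 v - dotp c0 p.
have tau0 p : p \in s -> p != v -> 0 < tau p.
  move=> /Ps Pp pv; rewrite subr_gt0 lt_neqAle cv Pb0 // andbT.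
  apply: contra pv => /eqP cp; apply/eqP.
  by have : [set x | P x /\ dotp c0 x = b0] p by []; rewrite -eqv.
pose dir p := (tau p)^-1 *: (p - v).
pose H := [seq dir p | p <- s & p != v].
suff key : {in s, forall p, dotp n v <= dotp n p}.
  move=> x; rewrite eP => Px.
  suff : dotp (- n) x <= - dotp n v by rewrite -scaleN1r dotpZl mulN1r lerN2.
  by apply: convex_hull_le Px => p /key; rewrite -scaleN1r dotpZl mulN1r lerN2.
move=> p ps; rewrite leNgt; apply/negP => np.
have pv : p != v by apply: contraTneq np => ->; rewrite ltxx.
have dirP q : q \in s -> q != v -> dir q \in H.
  by move=> qs qv; apply/mapP; exists q; rewrite // mem_filter qv.
have [h /mapP[g]] := exposed_minimizer n (dirP _ ps pv).
rewrite mem_filter => /andP[gv gs] eh [hmin [c hc]].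
have g0 := tau0 g gs gv.
have nh : dotp n h < 0.
  apply: le_lt_trans (hmin _ (dirP _ ps pv)) _.
  by rewrite dotpZr dotpBr pmulr_rlt0 ?invr_gt0 ?tau0// subr_lt0.
have gE : g = v + tau g *: h.
  by rewrite eh scalerA mulfV ?gt_eqF// scale1r addrC subrK.
pose C := c + dotp c h *: c0.
have CE q : q \in s -> q != v -> dotp C q - dotp C v = tau q * (dotp c (dir q) - dotp c h).
  move=> qs qv; rewrite /C !dotpDl !dotpZl /dir dotpZr dotpBr mulrBr mulrA mulfV ?gt_eqF ?tau0//.
  by rewrite mul1r /tau; ring.
have Cle q : q \in s -> dotp C q <= dotp C v.
  move=> qs; have [->//|qv] := eqVneq q v.
  rewrite -subr_le0 CE // pmulr_rle0 ?tau0// subr_le0.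
  by have [->//|/(hc _ (dirP _ qs qv))/ltW] := eqVneq (dir q) h.
have Ceq q : q \in s -> dotp C q = dotp C v -> q - v = tau q *: h.
  move=> qs; have [->|qv] := eqVneq q v; first by rewrite /tau !subrr scale0r.
  move/eqP; rewrite -subr_eq0 CE // mulf_eq0 gt_eqF ?tau0//= subr_eq0 => /eqP e.
  have [<-|/(hc _ (dirP _ qs qv))] := eqVneq (dir q) h; last by rewrite e ltxx.
  by rewrite scalerA mulfV ?gt_eqF ?tau0// scale1r.
pose F := [set x | P x /\ dotp C x = dotp C v].
have Fline x : F x -> exists a : R, x - v = a *: h.
  move=> [+ Cx]; rewrite eP => -[m [q [a [sq a0 a1 ex]]]].
  exists (\sum_i a i * tau (q i)); rewrite scaler_suml.
  have -> : x - v = \sum_i a i *: (q i - v).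
    under eq_bigr do rewrite scalerBr.
    by rewrite big_split /= -ex sumrN -scaler_suml a1 scale1r.
  apply: eq_bigr => i _; rewrite -scalerA.
  have zero : \sum_i a i * (dotp C v - dotp C (q i)) = 0.
    under eq_bigr do rewrite mulrBr.
    rewrite big_split /= sumrN -mulr_suml a1 mul1r; apply/eqP.
    rewrite subr_eq0 -Cx ex dotp_sumr; apply/eqP/eq_bigr => j _.
    by rewrite dotpZr.
  have /psumr_eq0P : forall j, true -> 0 <= a j * (dotp C v - dotp C (q j)).
    by move=> j _; rewrite mulr_ge0 // subr_ge0 Cle //; exact: sq.
  move=> /(_ zero i isT) /eqP; rewrite mulf_eq0 => /orP[/eqP->|].
    by rewrite !scale0r.
  by rewrite subr_eq0 => /eqP e; rewrite -Ceq //; exact: sq.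
have Fv : F v by [].
have Fg : F g.
  split; first exact: Ps.
  by apply/eqP; rewrite -subr_eq0 CE // -eh subrr mulr0 eqxx //.
have eF : edge P F.
  split.
    exists C, (dotp C v); split=> // x; rewrite eP.
    by apply: convex_hull_le => q; exact: Cle.
  exists v, <[h]>%VS; split.
    rewrite dim_vline; apply/eqP; rewrite eqb1.
    by apply: contraTneq nh => ->; rewrite dotp0r ltxx.
  apply/seteqP; split=> x /=.
    move=> [m [q [a [Fq a1 ->]]]].
    have -> : \sum_i a i *: q i - v = \sum_i a i *: (q i - v).
      under [RHS]eq_bigr do rewrite scalerBr.
      by rewrite [RHS]big_split /= sumrN -scaler_suml a1 scale1r.
    apply: memv_suml => i _; apply: memvZ.
    by have [k ->] := Fline _ (Fq i); apply/memvZ/memv_line.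
  move=> /vlineP[k ek].
  exists 2%N, (fun i => if i == 0 then v else g),
    (fun i => if i == 0 then 1 - k / tau g else k / tau g).
  rewrite !big_ord_recl !big_ord0 /= !addr0; split.
  - by move=> i; rewrite -/(F _); case: ifP.
  - by rewrite subrK.
  - rewrite [X in _ + _ *: X]gE scalerDr scalerA divfK ?(gt_eqF g0)// -ek addrA -scalerDl subrK scale1r.
    by rewrite addrC subrK.
(* The primitive vector along the edge may come with the wrong orientation:
   [w'] below is [w] or [- w]. *)
have [u0 u0n0 line] := ratP _ eF.
have [a ea] := line _ _ Fv Fg.
have [w pw [k k0 ek]] := @primitive_scaling R _ _ u0n0.
have thE : tau g *: h = (a * k) *: intv R w.
  by rewrite -scalerA -ek -ea [X in _ = X - v]gE addrC addKr.
have ak0 : a * k != 0.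
  apply: contraTneq nh => ak0; move/eqP: thE; rewrite ak0 scale0r scaler_eq0.
  by rewrite gt_eqF //= => /eqP ->; rewrite dotp0r ltxx.
have [w' ev ew'] : exists2 w', edge_vectors P v w' &
    exists2 r : R, 0 < r & tau g *: h = r *: intv R w'.
  have [ak|ak|/eqP] := ltgtP 0 (a * k); last by rewrite eq_sym (negbTE ak0).
    exists w; last by exists (a * k).
    split=> //; exists F; split=> //; exists (a * k) => //.
    by rewrite -thE -gE.
  have E : tau g *: h = (- (a * k)) *: intv R (- w).
    by rewrite intvN scalerN scaleNr opprK.
  exists (- w); last by exists (- (a * k)); rewrite ?oppr_gt0.
  split; first exact: primitiveN.
  exists F; split=> //; exists (- (a * k)); first by rewrite oppr_gt0.
  by rewrite -E -gE.
case: ew' => r r0 er.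
have : dotp n (tau g *: h) < 0 by rewrite dotpZr pmulr_rlt0.
by rewrite er dotpZr ltNge mulr_ge0 ?hn // ltW.
Qed.

(** * Coordinate facets at a vertex *)

HB.instance Definition _ c := GRing.isLinear.Build R V R^o *%R (dotp c : V -> R^o)
  (fun a x y => etrans (dotpDr c (a *: x) y) (congr1 (+%R^~ _) (dotpZr c a x))).

Lemma hyperplane_has_dim {A : set V} {c y} {b : R} : dotp c y != 0 ->
  affine_hull A = [set x | dotp c x = b] ->
  exists2 k, has_dim A k & k.+1 = d.
Proof.
move=> cy hA.
pose f : 'Hom(V, R^o) := linfun (dotp c : V -> R^o).
have fE x : f x = dotp c x by rewrite lfunE.
exists (\dim (lker f)).
  exists ((b / dotp c y) *: y), (lker f); split=> //.
  rewrite hA; apply/seteqP; split=> x /=; rewrite memv_ker fE dotpBr dotpZr divfK //.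
    by move=> ->; rewrite subrr.
  by rewrite subr_eq0 => /eqP.
have dimV : dim V = d by rewrite dim_matrix; exact: mul1n.
have := limg_ker_dim f fullv; rewrite capfv dimvf dimV => {3}<-.
suff -> : \dim (limg f) = 1%N by rewrite addn1.
apply/eqP; rewrite eqn_leq; apply/andP; split.
  by rewrite (leq_trans (dimvS (subvf _))) // dimvf.
rewrite lt0n dimv_eq0; apply: contra cy => /eqP e.
by have := memv_img f (memvf y); rewrite e memv0 fE.
Qed.

(** The points [v] and [v + b j], for [j != l], lie on this face and affinely
    span the hyperplane. *)
Lemma coordinate_facet {P v} {b n : 'I_d -> 'rV[int]_d} l :
  (forall i j, dotp (intv R (n i)) (intv R (b j)) = (i == j)%:R) ->
  (forall x : V, x = \sum_i dotp (intv R (n i)) x *: intv R (b i)) ->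
  P v -> (forall j, P (v + intv R (b j))) ->
  (forall x, P x -> dotp (intv R (n l)) v <= dotp (intv R (n l)) x) ->
  let F := [set x | P x /\ dotp (intv R (n l)) x = dotp (intv R (n l)) v] in
  facet P F /\ affine_hull F = [set x | dotp (intv R (n l)) x = dotp (intv R (n l)) v].
Proof.
move=> dual expand Pv Pb minl F.
have hull : affine_hull F = [set x | dotp (intv R (n l)) x = dotp (intv R (n l)) v].
  apply/seteqP; split=> x /=.
    move=> [m [q [a [Fq a1 ->]]]]; rewrite dotp_sumr -[RHS]mul1r -a1 mulr_suml.
    by apply: eq_bigr => i _; rewrite dotpZr (Fq i).2.
  move=> xl; pose z j := dotp (intv R (n j)) (x - v).
  have zl : z l = 0 by rewrite /z dotpBr xl subrr.
  (* As [z l = 0], the index [l] is free to carry the apex [v], with the weight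
     that makes the coefficients sum to 1. *)
  exists d, (fun j => if j == l then v else v + intv R (b j)),
    (fun j => if j == l then 1 - \sum_(i | i != l) z i else z j); split.
  - move=> j; case: eqVneq => // jl; split=> //.
    by rewrite dotpDr dual eq_sym (negbTE jl) addr0.
  - rewrite (bigD1 l) //= eqxx -[RHS](subrK (\sum_(i | i != l) z i)); congr (_ + _).
    by apply: eq_bigr => j /negbTE ->.
  - rewrite (bigD1 l) //= eqxx.
    rewrite (eq_bigr (fun j => z j *: v + z j *: intv R (b j))); last first.
      by move=> j /negbTE ->; rewrite scalerDr.
    rewrite big_split /= -scaler_suml addrA -scalerDl subrK scale1r.
    rewrite -[LHS](subrK v) [LHS]addrC; congr (_ + _); rewrite [LHS]expand.
    by rewrite (bigD1 l) //= -/(z l) zl scale0r add0r.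
split=> //; split; last first.
  by apply: (hyperplane_has_dim (y := intv R (b l)) _ hull); rewrite dual eqxx oner_eq0.
exists (- intv R (n l)), (- dotp (intv R (n l)) v); split.
  by move=> x Px; rewrite -scaleN1r dotpZl mulN1r lerN2 minl.
apply/seteqP; split=> x /= [Px]; rewrite -scaleN1r dotpZl mulN1r.
  by move=> ->.
by move/oppr_inj.
Qed.

Lemma interior_neg_direction {P x} : P° 0 -> exists2 t : R, 0 < t & P (- (t *: x)).
Proof.
move=> P0.
have cv : (fun t : R => - (t *: x)) @ 0 --> (0 : V).
  have -> : (0 : V) = - ((0 : R) *: x) by rewrite scale0r oppr0.
  by apply: cvgN; apply: cvgZr_tmp; exact: cvg_id.
have /= := cv _ P0.
move=> /nbhs_ballP[e /= e0 he]; exists (e / 2); first by rewrite divr_gt0.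
apply: he; rewrite /ball /= sub0r normrN gtr0_norm ?divr_gt0//.
by rewrite ltr_pdivrMr // ltr_pMr // ltr1n.
Qed.

(** All coordinates of the origin at [v'] are positive integers, and all but
    the one along [w] equal 1, so that the sum [v'] plus the other edge vectors
    is a multiple of [- w] by a positive integer. *)
Lemma opposite_edge_vector {P v v'} {w} {k : R} : deeply_smooth P -> P° 0 ->
  next_to P [set v] 0 -> vertex P v -> vertex P v' -> edge_vectors P v' w ->
  v = v' + k *: intv R w -> P (- intv R w).
Proof.
move=> [[polP _ _ ratP basisP] [_ latP] deepP] P0 [_ [_ dist1]] vv vv' ew ev.
have [b [/dual_basis-/(_ R)[n [prim dual expand]] eb]] := basisP _ vv'.
have [vz _ vzE] := latP _ vv'.
have Pvertex y : vertex P y -> P y.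
  by move=> [c [a [_ e]]]; have : [set y] y by []; rewrite e => -[].
have Pb j : P (v' + intv R (b j)).
  have := deepP _ vv' b (esym eb) (fun i => (i == j)%:R).
  rewrite (bigD1 j) //= eqxx scale1r big1 ?addr0; first last.
    by move=> i /negbTE ->; rewrite scale0r.
  by apply=> i; case: (i == j); rewrite ?ler01 ?lexx.
have minP l x : P x -> dotp (intv R (n l)) v' <= dotp (intv R (n l)) x.
  apply: edge_vectors_span_cone => // u; rewrite eb => -[j _ <-].
  by rewrite dual ler0n.
(* [z l] is the coordinate of the origin along [b l], as an integer. *)
pose z l := - \sum_i n l 0 i * vz 0 i.
have zE l : dotp (intv R (n l)) v' = - (z l)%:~R.
  by rewrite -vzE dotp_intv /z rmorphN opprK.
have z0 l : 0 < z l.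
  have [t t0 Pt] := @interior_neg_direction P (intv R (b l)) P0.
  have := minP l _ Pt; rewrite zE -scaleNr dotpZr dual eqxx mulr1 lerN2.
  by move=> /(lt_le_trans t0); rewrite ltr0z.
have [i _ wE] : range b w by rewrite -eb.
have z1 l : l != i -> z l = 1.
  move=> li; apply/eqP; rewrite eq_le -gtz0_ge1 z0 andbT -(ler_int R).
  have [facetF hullF] := coordinate_facet l dual expand (Pvertex _ vv') Pb (minP l).
  apply: dist1; eexists; split; first exact: facetF.
    move=> _ ->; split; first exact: Pvertex.
    by rewrite ev dotpDr dotpZr -wE dual (negbTE li) mulr0 addr0.
  exists (n l), (dotp (intv R (n l)) v'); split=> //.
  by rewrite dotp0r subr0 zE normrN gtr0_norm // ltr0z.
have zi1 : 1 <= (z i)%:~R :> R by rewrite (ler_int R 1) -gtz0_ge1.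
have Pm : P (- ((z i)%:~R *: intv R w)).
  have := deepP _ vv' b (esym eb) (fun l => (l != i)%:R).
  have -> : v' + \sum_l (l != i)%:R *: intv R (b l) = - ((z i)%:~R *: intv R w).
    rewrite {1}(expand v') -big_split /= (bigD1 i) //= zE eqxx scale0r addr0.
    rewrite wE scaleNr big1 ?addr0 // => l li.
    by rewrite li zE (z1 _ li) scale1r scaleN1r addrC subrr.
  by apply=> l; case: (l != i); rewrite ?ler01 ?lexx.
have P0' : P 0 by exact: interior_subset.
have zn0 : (z i)%:~R != 0 :> R by rewrite gt_eqF // (lt_le_trans _ zi1).
have -> : - intv R w = ((z i)%:~R)^-1 *: (- ((z i)%:~R *: intv R w))
    + (1 - ((z i)%:~R)^-1) *: 0.
  by rewrite scaler0 addr0 scalerN scalerA mulVf // scale1r.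
have [s eP] := polP; rewrite eP in Pm P0' *.
apply: convex_hull_segment => //.
by rewrite invr_ge0 (le_trans ler01 zi1) /= invf_le1 // (lt_le_trans _ zi1).
Qed.
End Faces.

(** * The edge basis next to the origin *)

Theorem proposition7p5 (R : realType) (d : nat) (P : set 'rV[R]_d)
    (v : 'rV[R]_d) (hP : deeply_smooth P) (h0 : P° 0) (hv : vertex P v)
    (hnext : next_to P [set v] 0) :
  lattice_basis (edge_vectors P v) /\
  [set intv R u | u in edge_vectors P v] `<=` ewald P.
Proof.
have [[polP _ _ ratP basisP] _ _] := hP.
split; first exact: basisP.
move=> _ [u eu <-]; split; last first.
  exists (- intv R u); last by rewrite opprK.
  apply: (opposite_edge_vector (k := 0) hP h0 hnext hv hv eu).
  by rewrite scale0r addr0.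
split; first by exists u.
have [v' [vv' eNu [k ev]]] := edge_other_end polP ratP eu.
rewrite -[intv R u]opprK -intvN.
exact: opposite_edge_vector hP h0 hnext hv vv' eNu ev.
Qed.
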